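(* For every homogeneous space $X$, i.e. every diffeological space $X$ diffeomorphic to $G/H$ for some diffeological group $G$ and some subgroup $H$ of $G$, we have $T^H X = T^{dvs} X$ (as diffeological spaces).
   Context: A diffeological space is a set $X$ with, for each $n \ge 0$ and each open $U \subseteq \mathbb{R}^n$, a specified set of functions $U \to X$ called plots, such that: every constant function $U\to X$ is a plot; if $U \to X$ is a plot and $V \to U$ is a smooth map between open subsets of Euclidean spaces, the composite $V \to X$ is a plot; and a function $U \to X$ whose restriction to each member of some open cover of $U$ is a plot is itself a plot. A function $f : X \to Y$ is smooth if $f \circ p$ is a plot of $Y$ for every plot $p$ of $X$. Isomorphisms are called diffeomorphisms. Subsets carry the sub-diffeology (plots are the functions whose composite to the ambient space is a plot); products and pullbacks carry the product diffeology and its sub-diffeology; a quotient carries the quotient diffeology, whose plots are the functions that locally lift to plots of the original space. A diffeological group is a group with a diffeology for which multiplication and inversion are smooth. For a subgroup $H$ (no closedness assumed), $G/H$ is the set of cosets $gH$ with the quotient diffeology. A pointed plot $p : (U,0) \to (X,x)$ is a plot $p:U\to X$ where $U$ is a connected open neighbourhood of $0$ in some $\mathbb{R}^n$ and $p(0) = x$. The germ category $\mathcal{G}(X,x)$ has the pointed plots as objects; a morphism from $p : (U,0)\to (X,x)$ to $q : (V,0) \to (X,x)$ is the germ at $0$ of a smooth map $f : W \to V$, with $W$ an open neighbourhood of $0$ in $U$, $f(0)=0$ and $p|_W = q \circ f$. The internal tangent space $T_x(X)$ is the colimit, in real vector spaces, of the functor $\mathcal{G}(X,x) \to \mathrm{Vect}$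 sending $p : (U,0) \to (X,x)$ to $T_0(U)$ and a germ $f$ to its derivative at $0$. Let $TX = \coprod_{x \in X} T_x(X)$ with projection to $X$. For a plot $p : U \to X$, let $Tp : TU \to TX$ send $v \in T_u U$ to the element of $T_{p(u)}(X)$ represented by $v$ at the pointed plot $w \mapsto p(u+w)$ (defined near $0$). $T^H X$ (Hector's diffeology) is $TX$ with the smallest diffeology making all $Tp$ smooth; its plots are the functions that locally are constant or of the form $Tp \circ f$ with $f : U' \to TU$ smooth. $T^{dvs} X$ is $TX$ with the smallest diffeology containing Hector's diffeology and making $TX$ a diffeological vector space over $X$, i.e. such that the projection to $X$, the fiberwise addition $TX \times_X TX \to TX$ and the scalar multiplication $TX \times \mathbb{R} \to TX$ are smooth. *)

(* Defs.v *)
From HB Require Import structures.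
From mathcomp Require Import all_boot all_order all_algebra.
From mathcomp Require Import all_classical all_reals all_analysis.
Import Order.TTheory GRing.Theory Num.Theory.
Import numFieldNormedType.Exports.
Set Implicit Arguments. Unset Strict Implicit. Unset Printing Implicit Defensive.
Local Open Scope classical_set_scope.
Local Open Scope ring_scope.

Section Smooth.
Context {R : realType}.

(* [f] is C^k on the open set [U]. In finite dimension the derivative
   [x |-> 'd f x] is C^k exactly when each [x |-> 'd f x v] is. *)
Fixpoint Ck (k : nat) (V W : normedModType R) (U : set V) (f : V -> W) : Prop :=
  match k with
  | 0 => forall x, U x -> {for x, continuous f}
  | k.+1 => (forall x, U x -> differentiable f x) /\
            (forall v, Ck k U (fun x => 'd f x v))
  end.

Definition smooth_on (V W : normedModType R) (U : set V) (f : V -> W) : Prop :=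
  forall k, Ck k U f.

Lemma near_eq_differentiable (V W : normedModType R) (f g : V -> W) (x : V) :
  {near x, f =1 g} -> differentiable f x -> differentiable g x.
Proof.
move=> fg /diff_locallyP[dfc dfE].
have E : g \o shift x = cst (g x) + 'd f x +o_ 0 id.
  apply/eqaddoP => e e0.
  have /eqaddoP/(_ e e0) H := dfE.
  have {}fg : \forall y \near (0 : V), f (y + x) = g (y + x).
    by have := fg; rewrite (near_shift 0 x)/= ; apply: filterS => y; rewrite subr0.
  near=> y.
  have fgx : f x = g x by have := nbhs_singleton fg; rewrite add0r.
  have fgy : f (y + x) = g (y + x) by near: y.
  by rewrite !fctE/= -fgx -fgy; near: y.
by apply/diff_locallyP; rewrite (diff_unique dfc E).
Unshelve. all: by end_near. Qed.

Lemma near_eq_diff (V W : normedModType R) (f g : V -> W) (x v : V) :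
  {near x, f =1 g} -> differentiable f x -> 'd f x v = 'd g x v.
Proof.
move=> fg df; rewrite -!deriveE//; last exact: near_eq_differentiable df.
exact: near_eq_derive.
Qed.

Lemma Ck_ext k (V W : normedModType R) (U : set V) (f g : V -> W) :
  open U -> (forall x, U x -> f x = g x) -> Ck k U f -> Ck k U g.
Proof.
move=> Uo; elim: k f g => [|k IH] f g fg.
  move=> fc x Ux; have Un : nbhs x U by exact: open_nbhs_nbhs.
  rewrite /prop_for /continuous_at -(fg _ Ux); apply: cvg_trans (fc x Ux).
  by apply: near_eq_cvg; near=> y; apply: fg; near: y.
have nfg x : U x -> {near x, f =1 g}.
  by move=> Ux; near=> y; apply: fg; near: y; exact: open_nbhs_nbhs.
move=> [df ddf]; split=> [x Ux|v].
  exact: near_eq_differentiable (nfg _ Ux) (df _ Ux).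
apply: IH (ddf v) => x Ux; apply: near_eq_diff; [exact: nfg|exact: df].
Unshelve. all: by end_near. Qed.

Lemma CkS k (V W : normedModType R) (U : set V) (f : V -> W) :
  Ck k.+1 U f -> Ck k U f.
Proof.
elim: k f => [|k IH] f [df ddf].
  by move=> x Ux; apply: differentiable_continuous; exact: df.
by split=> // v; exact: IH (ddf v).
Qed.

Lemma CkW k (V W : normedModType R) (U U' : set V) (f : V -> W) :
  U' `<=` U -> Ck k U f -> Ck k U' f.
Proof.
move=> U'U; elim: k f => [|k IH] f; first by move=> fc x /U'U; exact: fc.
by move=> [df ddf]; split=> [x /U'U /df//|v]; exact: IH (ddf v).
Qed.

Lemma Ck_bigcup k (V W : normedModType R) (C : set (set V)) (f : V -> W) :
  (forall U, C U -> Ck k U f) -> Ck k (\bigcup_(U in C) U) f.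
Proof.
elim: k f => [|k IH] f H; first by move=> x [U CU Ux]; exact: H Ux.
split=> [x [U CU Ux]|v]; first exact: (H U CU).1.
by apply: IH => U CU; exact: (H U CU).2.
Qed.

Lemma Ck_cst k (V W : normedModType R) (U : set V) (w : W) : Ck k U (cst w).
Proof.
elim: k w => [|k IH] w /=; first by move=> x _; exact: cst_continuous.
split=> [x _|v]; first exact: differentiable_cst.
by rewrite (_ : (fun x => _) = cst 0)//; apply/funext => x; rewrite diff_cst.
Qed.

Lemma Ck_lin k (V W : normedModType R) (U : set V) (f : {linear V -> W}) :
  continuous f -> Ck k U f.
Proof.
move=> cf; case: k => [|k] /=; first by move=> x _; exact: cf.
split=> [x _|v]; first exact: linear_differentiable.
rewrite (_ : (fun x => _) = cst (f v)); first exact: Ck_cst.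
by apply/funext => x; rewrite diff_lin.
Qed.

Lemma Ck_add k (V W : normedModType R) (U : set V) (f g : V -> W) :
  open U -> Ck k U f -> Ck k U g -> Ck k U (f + g).
Proof.
move=> Uo; elim: k f g => [|k IH] f g.
  by move=> cf cg x Ux; apply: continuousD; [exact: cf|exact: cg].
move=> [df ddf] [dg ddg]; split=> [x Ux|v].
  by apply: differentiableD; [exact: df|exact: dg].
apply: (Ck_ext Uo _ (IH _ _ (ddf v) (ddg v))) => x Ux.
by rewrite diffD ?fctE//; [exact: df|exact: dg].
Qed.

Lemma Ck_sum k (V W : normedModType R) (U : set V) n (f : 'I_n -> V -> W) :
  open U -> (forall i, Ck k U (f i)) -> Ck k U (\sum_(i < n) f i).
Proof.
move=> Uo H; elim/big_ind: _ => //; first exact: Ck_cst.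
by move=> g h; exact: Ck_add.
Qed.

Lemma scale_is_diff (V W : normedModType R) (r : V -> R) (f : V -> W) x :
  differentiable r x -> differentiable f x ->
  is_diff x (fun y => r y *: f y)
    (fun v => r x *: 'd f x v + 'd r x v *: f x).
Proof.
move=> dr df.
pose B := (@GRing.scale R W).
have bB : bilinear_for (GRing.Scale.Law.clone _ _ *:%R _)
   (GRing.Scale.Law.clone _ _ *:%R _) B.
  split=> [u'|u] a y z /=; first by rewrite /B scalerDl scalerA.
  by rewrite /B scalerDr !scalerA mulrC.
pose bM := bilinear_isBilinear.Build R R W W _ _ B bB.
pose bL : {bilinear R -> W -> W} := HB.pack B bM.
have cB : continuous (fun p : R * W => bL p.1 p.2).
  move=> p; apply: (@scale_continuous).
have d1 : differentiable (fun y => (r y, f y)) x by exact: differentiable_pair.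
have d2 : differentiable (fun p : R * W => bL p.1 p.2) (r x, f x).
  exact: differentiable_bilin.
have := @differentiable_comp _ _ _ _ _ (fun p : R * W => bL p.1 p.2) x d1 d2.
move=> d3; apply: DiffDef; first exact: d3.
rewrite (_ : (fun y => r y *: f y) = (fun p : R * W => bL p.1 p.2) \o (fun y => (r y, f y)))//.
rewrite diff_comp//; apply/funext => v /=.
by rewrite (diff_bilin _ cB) /= (diff_pair dr df).
Qed.

Lemma Ck_scale k (V W : normedModType R) (U : set V) (r : V -> R) (f : V -> W) :
  open U -> Ck k U r -> Ck k U f -> Ck k U (fun x => r x *: f x).
Proof.
move=> Uo; elim: k r f => [|k IH] r f.
  by move=> cr cf x Ux; apply: continuousZ; [exact: cr|exact: cf].
move=> cr cf; have [dr ddr] := cr; have [df ddf] := cf.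
have D x : U x -> _ := fun Ux => scale_is_diff (dr x Ux) (df x Ux).
split=> [x Ux|v]; first by have := D x Ux => ?; exact: ex_diff.
have H := Ck_add Uo (IH _ _ (CkS cr) (ddf v)) (IH _ _ (ddr v) (CkS cf)).
apply: Ck_ext Uo _ H => x Ux; have := D x Ux => ?.
by rewrite (@diff_val _ _ _ _ _ _ _ (D x Ux)).
Qed.

Lemma Ck_lincomp k (V W Z : normedModType R) (U : set V) (l : {linear W -> Z})
  (f : V -> W) : open U -> continuous l -> Ck k U f -> Ck k U (l \o f).
Proof.
move=> Uo cl; elim: k f => [|k IH] f.
  by move=> cf x Ux; apply: continuous_comp; [exact: cf|exact: cl].
move=> [df ddf]; split=> [x Ux|v].
  by apply: differentiable_comp; [exact: df|exact: linear_differentiable].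
apply: Ck_ext Uo _ (IH _ (ddf v)) => x Ux.
rewrite diff_comp/=; [|exact: df|exact: linear_differentiable].
by rewrite diff_lin.
Qed.

Lemma linear_row n (W : lmodType R) (L : {linear 'rV[R]_n -> W}) (w : 'rV[R]_n) :
  \sum_(i < n) w 0 i *: L (delta_mx 0 i) = L w.
Proof.
transitivity (L (\sum_j w 0 j *: delta_mx 0 j)).
  by rewrite linear_sum; apply: eq_bigr => i _; rewrite linearZ.
by rewrite -row_sum_delta.
Qed.

Lemma Ck_comp k m n (W : normedModType R) (U : set 'rV[R]_m) (V : set 'rV[R]_n)
  (g : 'rV[R]_m -> 'rV[R]_n) (f : 'rV[R]_n -> W) :
  open U -> (forall x, U x -> V (g x)) ->
  Ck k U g -> Ck k V f -> Ck k U (f \o g).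
Proof.
move=> Uo gUV; elim: k f => [|k IH] f.
  by move=> cg cf x Ux; apply: continuous_comp; [exact: cg|exact/cf/gUV].
move=> cg [df ddf]; have [dg ddg] := cg; split=> [x Ux|v].
  by apply: differentiable_comp; [exact: dg|exact/df/gUV].
pose co (i : 'I_n) (y : 'rV[R]_n) : R := y 0 i.
have coL i : linear (co i : 'rV[R]_n -> R).
  by move=> a y z; rewrite /co !mxE.
pose coM i := GRing.isLinear.Build _ _ _ _ _ (coL i).
pose coLi i : {linear 'rV[R]_n -> R} := HB.pack (co i) (coM i).
have H := @Ck_sum k _ _ U n (fun i x => coLi i ('d g x v) *: ('d f (g x) (delta_mx 0 i))) Uo.
apply: (Ck_ext Uo _ (H _)) => [x Ux|i].
  rewrite diff_comp/=; [|exact: dg|exact/df/gUV].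
  by rewrite fct_sumE; exact: linear_row.
apply: Ck_scale => //.
  by apply: (Ck_lincomp Uo) (ddg v) => y; exact: coord_continuous.
by apply: IH (ddf _); exact: CkS.
Qed.
End Smooth.

(* A function on an open set [U] is represented by a total function, considered
   only up to its values on [U] (field [plot_ext]); [X] may only lack such total
   extensions when it is empty, in which case [U] is empty as well. *)
Record diffeology (R : realType) (X : Type) := Diffeology {
  plot : forall n, set 'rV[R]_n -> ('rV[R]_n -> X) -> Prop;
  plot_open : forall n (U : set 'rV[R]_n) p, plot U p -> open U;
  plot_ext : forall n (U : set 'rV[R]_n) p q,
    (forall u, U u -> p u = q u) -> plot U p -> plot U q;
  plot_cst : forall n (U : set 'rV[R]_n) x, open U -> plot U (cst x);
  plot_comp : forall m n (U : set 'rV[R]_n) (V : set 'rV[R]_m) p f,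
    plot U p -> open V -> smooth_on V f -> (forall v, V v -> U (f v)) ->
    plot V (p \o f);
  plot_local : forall n (C : set (set 'rV[R]_n)) p,
    (forall W, C W -> plot W p) -> plot (\bigcup_(W in C) W) p
}.
Arguments plot {R X} d {n} U p.

Section Constructions.
Context {R : realType}.

Lemma diffeology_eq (X : Type) (D E : diffeology R X) :
  (forall n (U : set 'rV[R]_n) p, plot D U p <-> plot E U p) -> D = E.
Proof.
case: D E => [P a1 a2 a3 a4 a5] [Q b1 b2 b3 b4 b5] /= PQ.
have E : P = Q.
  by apply: functional_extensionality_dep => n; apply/funext => U; apply/funext => p;
    exact/propext/PQ.
by move: a1 a2 a3 a4 a5 b1 b2 b3 b4 b5; rewrite E => *; congr Diffeology;
  exact: Prop_irrelevance.
Qed.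

Lemma plotW (X : Type) (D : diffeology R X) n (U V : set 'rV[R]_n) p :
  open V -> V `<=` U -> plot D U p -> plot D V p.
Proof.
move=> Vo VU Dp; apply: (plot_comp Dp Vo (f := idfun)) => //.
by move=> k; apply: (@Ck_lin _ k _ _ V idfun) => x; exact: cvg_id.
Qed.

Definition smooth (X Y : Type) (D : diffeology R X) (E : diffeology R Y)
  (f : X -> Y) : Prop :=
  forall n (U : set 'rV[R]_n) p, plot D U p -> plot E U (f \o p).

Definition diffeomorphism (X Y : Type) (D : diffeology R X) (E : diffeology R Y)
  (f : X -> Y) : Prop :=
  smooth D E f /\ exists g, [/\ smooth E D g, cancel f g & cancel g f].

Section Standard.
Context (W : normedModType R).
Let P n (U : set 'rV[R]_n) (p : 'rV[R]_n -> W) := open U /\ smooth_on U p.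

Fact std_open n (U : set 'rV[R]_n) p : P U p -> open U. Proof. by case. Qed.
Fact std_ext n (U : set 'rV[R]_n) p q :
  (forall u, U u -> p u = q u) -> P U p -> P U q.
Proof. by move=> pq [Uo sp]; split=> // k; exact: (Ck_ext Uo pq (sp k)). Qed.
Fact std_cst n (U : set 'rV[R]_n) w : open U -> P U (cst w).
Proof. by move=> Uo; split=> // k; exact: Ck_cst. Qed.
Fact std_comp m n (U : set 'rV[R]_n) (V : set 'rV[R]_m) p f :
  P U p -> open V -> smooth_on V f -> (forall v, V v -> U (f v)) ->
  P V (p \o f).
Proof. by move=> [Uo sp] Vo sf fVU; split=> // k; exact: (Ck_comp Vo fVU (sf k) (sp k)). Qed.
Fact std_local n (C : set (set 'rV[R]_n)) p :
  (forall U, C U -> P U p) -> P (\bigcup_(U in C) U) p.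
Proof.
move=> H; split=> [|k]; first by apply: bigcup_open => U /H[].
by apply: Ck_bigcup => U /H[_]; exact.
Qed.

Definition std : diffeology R W :=
  Diffeology std_open std_ext std_cst std_comp std_local.
End Standard.

Section Product.
Context {X Y : Type} (D : diffeology R X) (E : diffeology R Y).
Let P n (U : set 'rV[R]_n) (p : 'rV[R]_n -> X * Y) :=
  plot D U (fst \o p) /\ plot E U (snd \o p).

Fact prod_open n (U : set 'rV[R]_n) p : P U p -> open U.
Proof. by case=> /plot_open. Qed.
Fact prod_ext n (U : set 'rV[R]_n) p q :
  (forall u, U u -> p u = q u) -> P U p -> P U q.
Proof.
by move=> pq [Dp Ep]; split; [apply: plot_ext Dp|apply: plot_ext Ep] => u Uu /=;
  rewrite pq.
Qed.
Fact prod_cst n (U : set 'rV[R]_n) z : open U -> P U (cst z).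
Proof. by move=> Uo; split; exact: plot_cst. Qed.
Fact prod_comp m n (U : set 'rV[R]_n) (V : set 'rV[R]_m) p f :
  P U p -> open V -> smooth_on V f -> (forall v, V v -> U (f v)) ->
  P V (p \o f).
Proof.
by move=> [Dp Ep] Vo sf fVU; split; [exact: (plot_comp Dp)|exact: (plot_comp Ep)].
Qed.
Fact prod_local n (C : set (set 'rV[R]_n)) p :
  (forall U, C U -> P U p) -> P (\bigcup_(U in C) U) p.
Proof. by move=> H; split; apply: plot_local => U /H[]. Qed.

Definition prod_diff : diffeology R (X * Y) :=
  Diffeology prod_open prod_ext prod_cst prod_comp prod_local.
End Product.

Section Pullback.
Context {X Y : Type} (D : diffeology R X) (h : Y -> X).
Let P n (U : set 'rV[R]_n) (p : 'rV[R]_n -> Y) := plot D U (h \o p).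

Fact pull_open n (U : set 'rV[R]_n) p : P U p -> open U.
Proof. exact: plot_open. Qed.
Fact pull_ext n (U : set 'rV[R]_n) p q :
  (forall u, U u -> p u = q u) -> P U p -> P U q.
Proof. by move=> pq; apply: plot_ext => u Uu /=; rewrite pq. Qed.
Fact pull_cst n (U : set 'rV[R]_n) z : open U -> P U (cst z).
Proof. by move=> Uo; exact: (plot_cst D (h z) Uo). Qed.
Fact pull_comp m n (U : set 'rV[R]_n) (V : set 'rV[R]_m) p f :
  P U p -> open V -> smooth_on V f -> (forall v, V v -> U (f v)) ->
  P V (p \o f).
Proof. exact: plot_comp. Qed.
Fact pull_local n (C : set (set 'rV[R]_n)) p :
  (forall U, C U -> P U p) -> P (\bigcup_(U in C) U) p.
Proof. exact: plot_local. Qed.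

Definition pull_diff : diffeology R Y :=
  Diffeology pull_open pull_ext pull_cst pull_comp pull_local.
End Pullback.

Definition sub_diff (X : Type) (D : diffeology R X) (S : set X) :
  diffeology R {x | S x} := pull_diff D sval.

Section Quotient.
Context {X Y : Type} (D : diffeology R X) (pr : X -> Y)
  (pr_surj : forall y, exists x, pr x = y).
Let P n (U : set 'rV[R]_n) (q : 'rV[R]_n -> Y) := open U /\
  forall u, U u -> exists (W : set 'rV[R]_n) (p : 'rV[R]_n -> X),
    [/\ W u, W `<=` U, plot D W p & forall w, W w -> q w = pr (p w)].

Fact quot_open n (U : set 'rV[R]_n) p : P U p -> open U. Proof. by case. Qed.
Fact quot_ext n (U : set 'rV[R]_n) p q :
  (forall u, U u -> p u = q u) -> P U p -> P U q.
Proof.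
move=> pq [Uo H]; split=> // u /H[W [r [Wu WU Dr rE]]].
by exists W, r; split=> // w Ww; rewrite -rE// pq//; exact: WU.
Qed.
Fact quot_cst n (U : set 'rV[R]_n) y : open U -> P U (cst y).
Proof.
move=> Uo; split=> // u Uu; have [x xy] := pr_surj y.
by exists U, (cst x); split=> //; exact: plot_cst.
Qed.
Fact quot_comp m n (U : set 'rV[R]_n) (V : set 'rV[R]_m) p f :
  P U p -> open V -> smooth_on V f -> (forall v, V v -> U (f v)) ->
  P V (p \o f).
Proof.
move=> [Uo H] Vo sf fVU; split=> // v Vv.
have [W [r [Wfv WU Dr rE]]] := H _ (fVU _ Vv).
have Wo := plot_open Dr.
have Zo : open (V `&` f @^-1` W).
  rewrite openE => z [Vz Wz]; apply: filterI; first exact: open_nbhs_nbhs.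
  by apply: (sf 0%N z Vz); exact: open_nbhs_nbhs.
exists (V `&` f @^-1` W), (r \o f); split=> //.
- apply: (plot_comp Dr Zo) => [k|z []//].
  by apply: CkW (sf k) => z [].
- by move=> w [_ Ww] /=; exact: rE.
Qed.
Fact quot_local n (C : set (set 'rV[R]_n)) p :
  (forall U, C U -> P U p) -> P (\bigcup_(U in C) U) p.
Proof.
move=> H; split=> [|u [U CU Uu]]; first by apply: bigcup_open => U /H[].
have [_ /(_ u Uu)[W [r [Wu WU Dr rE]]]] := H _ CU.
by exists W, r; split=> // w Ww; exists U => //; exact: WU.
Qed.

Definition quot_diff : diffeology R Y :=
  Diffeology quot_open quot_ext quot_cst quot_comp quot_local.
End Quotient.

Section Inter.
Context {X : Type} (F : set (diffeology R X)).
Let P n (U : set 'rV[R]_n) (p : 'rV[R]_n -> X) :=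
  open U /\ forall D, F D -> plot D U p.

Fact inter_open n (U : set 'rV[R]_n) p : P U p -> open U. Proof. by case. Qed.
Fact inter_ext n (U : set 'rV[R]_n) p q :
  (forall u, U u -> p u = q u) -> P U p -> P U q.
Proof. by move=> pq [Uo H]; split=> // D FD; exact: plot_ext pq (H D FD). Qed.
Fact inter_cst n (U : set 'rV[R]_n) z : open U -> P U (cst z).
Proof. by move=> Uo; split=> // D FD; exact: plot_cst. Qed.
Fact inter_comp m n (U : set 'rV[R]_n) (V : set 'rV[R]_m) p f :
  P U p -> open V -> smooth_on V f -> (forall v, V v -> U (f v)) ->
  P V (p \o f).
Proof.
by move=> [Uo H] Vo sf fVU; split=> // D FD; exact: (plot_comp (H D FD)).
Qed.
Fact inter_local n (C : set (set 'rV[R]_n)) p :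
  (forall U, C U -> P U p) -> P (\bigcup_(U in C) U) p.
Proof.
move=> H; split=> [|D FD]; first by apply: bigcup_open => U /H[].
by apply: plot_local => U /H[_]; exact.
Qed.

(* The intersection of the members of [F]; it is the smallest member of [F] as
   soon as it belongs to [F]. *)
Definition inter_diff : diffeology R X :=
  Diffeology inter_open inter_ext inter_cst inter_comp inter_local.
End Inter.

Definition finer (X : Type) (D E : diffeology R X) : Prop :=
  forall n (U : set 'rV[R]_n) p, plot D U p -> plot E U p.

End Constructions.

Definition diffeological_group (R : realType) (G : groupType)
  (D : diffeology R G) : Prop :=
  smooth (prod_diff D D) D (fun gh => (gh.1 * gh.2)%g) /\
  smooth D D (fun g => (g^-1)%g).

Section Cosets.
Context {G : groupType} (H : {pred G}).

Definition coset_set (g : G) : set G := [set (g * h)%g | h in [set` H]].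

Definition coset_space : Type := {C : set G | exists g, C = coset_set g}.

Definition coset_proj (g : G) : coset_space :=
  exist _ (coset_set g) (ex_intro _ g erefl).

Fact coset_proj_surj (C : coset_space) : exists g, coset_proj g = C.
Proof. by case: C => C [g CE]; exists g; subst C. Qed.

Definition coset_diff (R : realType) (D : diffeology R G) :
  diffeology R coset_space := quot_diff D coset_proj_surj.
End Cosets.

Definition homogeneous (R : realType) (X : Type) (D : diffeology R X) : Prop :=
  exists (G : groupType) (DG : diffeology R G) (H : {pred G}),
    [/\ diffeological_group DG, group_closed H &
        exists f : X -> coset_space H, diffeomorphism D (coset_diff H DG) f].

Record diagram (R : realType) := Diagram {
  dg_obj : choiceType;
  dg_hom : dg_obj -> dg_obj -> Type;
  dg_space : dg_obj -> lmodType R;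
  dg_map : forall i j, dg_hom i j -> {linear dg_space i -> dg_space j}
}.

Section Colimit.
Context {R : realType} (G : diagram R).

Definition fsum : Type := seq {i : dg_obj G & dg_space i}.
HB.instance Definition _ := Choice.on fsum.

Definition single (i : dg_obj G) (v : dg_space i) : fsum := [:: existT _ i v].

(* The congruence on formal sums of vectors whose quotient is the direct sum of
   the spaces of the diagram modulo the vectors [v - dg_map h v]. *)
Inductive fsum_eq : fsum -> fsum -> Prop :=
| fsum_refl s : fsum_eq s s
| fsum_sym s t : fsum_eq s t -> fsum_eq t s
| fsum_trans s t u : fsum_eq s t -> fsum_eq t u -> fsum_eq s u
| fsum_cat s s' t t' : fsum_eq s s' -> fsum_eq t t' -> fsum_eq (s ++ t) (s' ++ t')
| fsum_comm s t : fsum_eq (s ++ t) (t ++ s)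
| fsum_zero i : fsum_eq (@single i 0) [::]
| fsum_add i (v w : dg_space i) :
    fsum_eq (single v ++ single w) (single (v + w))
| fsum_map i j (h : dg_hom i j) (v : dg_space i) :
    fsum_eq (single v) (single (dg_map h v)).

Definition fsum_eqb (s t : fsum) : bool := `[< fsum_eq s t >].

Fact fsum_eqb_refl : reflexive fsum_eqb.
Proof. by move=> s; apply/asboolP; exact: fsum_refl. Qed.
Fact fsum_eqb_sym : symmetric fsum_eqb.
Proof. by move=> s t; apply: asbool_equiv_eq; split; exact: fsum_sym. Qed.
Fact fsum_eqb_trans : transitive fsum_eqb.
Proof. by move=> t s u /asboolP st /asboolP tu; exact/asboolP/(fsum_trans st). Qed.

Canonical fsum_equiv := EquivRel fsum_eqb fsum_eqb_refl fsum_eqb_sym fsum_eqb_trans.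

Definition colim : Type := {eq_quot fsum_equiv}%qT.
HB.instance Definition _ := Choice.on colim.

Definition cpi (s : fsum) : colim := (\pi_({eq_quot fsum_equiv}) s)%qT.
Definition crep (x : colim) : fsum :=
  @repr _ ({eq_quot fsum_equiv}%qT : quotType fsum) x.

Lemma cpiP s t : cpi s = cpi t <-> fsum_eq s t.
Proof.
split=> [/eqmodP/asboolP//|st].
by apply/eqmodP; exact/asboolP.
Qed.

Lemma crepK x : cpi (crep x) = x. Proof. exact: reprK. Qed.
Lemma cpiK s : fsum_eq (crep (cpi s)) s.
Proof. by apply/cpiP; rewrite crepK. Qed.

Definition fscale (a : R) (s : fsum) : fsum :=
  [seq Tagged (fun i => dg_space i) (a *: tagged iv)
  | iv : {i : dg_obj G & dg_space i} <- s].

Lemma fscale_eq a s t : fsum_eq s t -> fsum_eq (fscale a s) (fscale a t).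
Proof.
elim=> {s t}.
- by move=> s; exact: fsum_refl.
- by move=> s t _; exact: fsum_sym.
- by move=> s t u _ + _; exact: fsum_trans.
- by move=> s s' t t' _ + _ +; rewrite /fscale !map_cat; exact: fsum_cat.
- by move=> s t; rewrite /fscale !map_cat; exact: fsum_comm.
- by move=> i; rewrite /fscale /= scaler0; exact: fsum_zero.
- by move=> i v w; rewrite /fscale /= scalerDr; exact: fsum_add.
- by move=> i j h v; rewrite /fscale /= -linearZ; exact: fsum_map.
Qed.

Lemma fscaleDl a b s : fsum_eq (fscale (a + b) s) (fscale a s ++ fscale b s).
Proof.
elim: s => [|[i v] s IH]; first exact: fsum_refl.
rewrite /= -!/(fscale _ _) scalerDl.
have H1 := fsum_sym (fsum_add (a *: v) (b *: v)).
apply: (fsum_trans (fsum_cat H1 IH)).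
rewrite /= -[X in fsum_eq _ X]/(single (a *: v) ++ _).
apply: (fsum_cat (fsum_refl (single (a *: v)))).
rewrite -cat1s -[X in fsum_eq _ (_ ++ X)]cat1s !catA.
by apply: fsum_cat (fsum_comm _ _) (fsum_refl _).
Qed.

Lemma fscale0 s : fsum_eq (fscale 0 s) [::].
Proof.
elim: s => [|[i v] s IH]; first exact: fsum_refl.
by rewrite /= scale0r -[[::]]/([::] ++ [::]); exact: (fsum_cat (fsum_zero i) IH).
Qed.

Lemma fscale1 s : fscale 1 s = s.
Proof. by rewrite /fscale -[RHS]map_id; apply: eq_map => -[i v]; rewrite /= scale1r. Qed.

Definition colim_add (x y : colim) : colim := cpi (crep x ++ crep y).
Definition colim_scale (a : R) (x : colim) : colim := cpi (fscale a (crep x)).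

Lemma cpiD s t : colim_add (cpi s) (cpi t) = cpi (s ++ t).
Proof. by apply/cpiP; apply: fsum_cat; exact: cpiK. Qed.

Lemma cpiZ a s : colim_scale a (cpi s) = cpi (fscale a s).
Proof. by apply/cpiP/fscale_eq/cpiK. Qed.

Fact colim_addA : associative colim_add.
Proof.
by move=> x y z; rewrite -(crepK x) -(crepK y) -(crepK z) !cpiD catA.
Qed.
Fact colim_addC : commutative colim_add.
Proof.
by move=> x y; rewrite -(crepK x) -(crepK y) !cpiD; apply/cpiP; exact: fsum_comm.
Qed.
Fact colim_add0 : left_id (cpi [::]) colim_add.
Proof. by move=> x; rewrite -(crepK x) cpiD. Qed.
Fact colim_addN : left_inverse (cpi [::]) (colim_scale (-1)) colim_add.
Proof.
move=> x; rewrite -(crepK x) cpiZ cpiD; apply/cpiP.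
rewrite -[X in _ ++ X]fscale1; apply: fsum_trans (fscale0 (crep x)).
by rewrite -(addNr 1); exact: fsum_sym (fscaleDl _ _ _).
Qed.
HB.instance Definition _ :=
  GRing.isZmodule.Build colim colim_addA colim_addC colim_add0 colim_addN.

Fact colim_scaleA a b x : colim_scale a (colim_scale b x) = colim_scale (a * b) x.
Proof.
rewrite -(crepK x) !cpiZ; congr cpi; rewrite /fscale -map_comp.
by apply: eq_map => -[i v]; rewrite /= scalerA.
Qed.
Fact colim_scale1 : left_id 1 colim_scale.
Proof. by move=> x; rewrite -(crepK x) cpiZ fscale1. Qed.
Fact colim_scaleDr : right_distributive colim_scale +%R.
Proof.
by move=> a x y; rewrite -(crepK x) -(crepK y) [_ + _]cpiD !cpiZ [RHS]cpiD
  /fscale map_cat.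
Qed.
Fact colim_scaleDl x : {morph colim_scale^~ x : a b / a + b}.
Proof.
by move=> a b; rewrite -(crepK x) !cpiZ [RHS]cpiD; apply/cpiP/fscaleDl.
Qed.
HB.instance Definition _ := GRing.Zmodule_isLmodule.Build R colim
  colim_scaleA colim_scale1 colim_scaleDr colim_scaleDl.

Definition colim_in (i : dg_obj G) (v : dg_space i) : colim := cpi (single v).

Fact colim_in_is_linear i : linear (@colim_in i).
Proof.
move=> a v w.
rewrite -[RHS]/(colim_add (colim_scale a (cpi (single v))) (cpi (single w))).
by rewrite cpiZ cpiD; apply/cpiP; apply: fsum_sym; exact: fsum_add.
Qed.
HB.instance Definition _ i := GRing.isLinear.Build R (dg_space i) colim _
  (@colim_in i) (@colim_in_is_linear i).

Lemma colim_in_map i j (h : dg_hom i j) v :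
  colim_in (dg_map h v) = colim_in v.
Proof. by apply/cpiP; exact: fsum_sym (fsum_map _ _). Qed.

Lemma colim_universal (W : lmodType R)
    (c : forall i, {linear dg_space i -> W}) :
    (forall i j (h : dg_hom i j) (v : dg_space i), c j (dg_map h v) = c i v) ->
  exists f : {linear colim -> W},
    (forall i (v : dg_space i), f (colim_in v) = c i v) /\
    (forall g : {linear colim -> W},
      (forall i (v : dg_space i), g (colim_in v) = c i v) -> g =1 f).
Proof.
move=> cE.
pose ev (s : fsum) : W :=
  \sum_(iv <- s) c (tag iv) (tagged iv).
have ev_eq s t : fsum_eq s t -> ev s = ev t.
  elim=> {s t} //.
  - by move=> s t u _ -> _ ->.
  - by move=> s s' t t' _ + _ +; rewrite /ev !big_cat /= => -> ->.
  - by move=> s t; rewrite /ev !big_cat /= addrC.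
  - by move=> i; rewrite /ev big_seq1 big_nil linear0.
  - by move=> i v w; rewrite /ev big_cat /= !big_seq1 linearD.
  - by move=> i j h v; rewrite /ev !big_seq1 cE.
pose f x := ev (crep x).
have fE s : f (cpi s) = ev s by apply: ev_eq; exact: cpiK.
have fL : linear f.
  move=> a x y; rewrite -(crepK x) -(crepK y).
  rewrite -[_ *: _ + _]/(colim_add (colim_scale a _) _) cpiZ cpiD !fE.
  rewrite /ev big_cat big_map /=; congr (_ + _).
  by rewrite scaler_sumr; apply: eq_bigr => iv _; rewrite linearZ.
pose fM := GRing.isLinear.Build _ _ _ _ _ fL.
pose fLi : {linear colim -> W} := HB.pack f fM.
exists fLi; split=> [i v|g gE x]; first by rewrite /= fE /ev big_seq1.
rewrite -(crepK x) [RHS]fE; elim: (crep x) => [|[i v] s IH].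
  by rewrite /ev big_nil -(linear0 g).
rewrite -[cpi _]/(cpi (single v ++ s)) -cpiD [LHS]linearD.
by rewrite [X in X + _]gE IH /ev big_cons.
Qed.
End Colimit.

Section Tangent.
Context {R : realType} {X : Type} (D : diffeology R X).

(* The values of [pp_map] outside [pp_dom] are irrelevant: the identity is an
   isomorphism of [germ]s between two extensions of the same pointed plot. *)
Record pplot (x : X) := PPlot {
  pp_dim : nat;
  pp_dom : set 'rV[R]_pp_dim;
  pp_map : 'rV[R]_pp_dim -> X;
  pp_plot : plot D pp_dom pp_map;
  pp_connected : connected pp_dom;
  pp_dom0 : pp_dom 0;
  pp_map0 : pp_map 0 = x
}.
Arguments pp_dom {x} p _.
Arguments pp_map {x} p _.
HB.instance Definition _ x := gen_eqMixin (pplot x).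
HB.instance Definition _ x := gen_choiceMixin (pplot x).

(* Representatives of germs: two of them with the same germ at [0] have the same
   differential there, hence define the same relation in the colimit below. *)
Record germ (x : X) (p q : pplot x) := Germ {
  gm_dom : set 'rV[R]_(pp_dim p);
  gm_map : 'rV[R]_(pp_dim p) -> 'rV[R]_(pp_dim q);
  gm_open : open gm_dom;
  gm_dom0 : gm_dom 0;
  gm_sub : gm_dom `<=` pp_dom p;
  gm_smooth : smooth_on gm_dom gm_map;
  gm_into : forall w, gm_dom w -> pp_dom q (gm_map w);
  gm_map0 : gm_map 0 = 0;
  gm_comm : forall w, gm_dom w -> pp_map p w = pp_map q (gm_map w)
}.

Arguments gm_map {x p q} g _.

Definition tangent_functor (x : X) : diagram R :=
  @Diagram R (pplot x) (@germ x) (fun p => 'rV[R]_(pp_dim p))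
    (fun p q g => 'd (gm_map g) (0 : 'rV[R]_(pp_dim p))).

Definition tspace (x : X) : lmodType R := colim (tangent_functor x).

Definition tvec (x : X) (p : pplot x) (v : 'rV[R]_(pp_dim p)) : tspace x :=
  @colim_in R (tangent_functor x) p v.

Definition tbundle : Type := {x : X & tspace x}.

Definition tproj (t : tbundle) : X := projT1 t.

Section Shift.
Context {n : nat} {U : set 'rV[R]_n} {p : 'rV[R]_n -> X} (pU : plot D U p).
Context {u : 'rV[R]_n} (Uu : U u).

(* Any connected open neighbourhood of [0] contained in [U - u] would do. *)
Definition shift_dom : set 'rV[R]_n :=
  connected_component [set w | U (u + w)] 0.

Definition shift_map (w : 'rV[R]_n) : X := p (u + w).

Fact shift_dom_sub w : shift_dom w -> U (u + w).
Proof. exact: connected_component_sub. Qed.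

Fact shift_dom0 : shift_dom 0.
Proof. by apply: connected_component_refl; rewrite /= addr0. Qed.

Fact shift_dom_connected : connected shift_dom.
Proof. exact: component_connected. Qed.

Fact shift_continuous (x : 'rV[R]_n) : continuous (fun w => x + w).
Proof. by move=> w; apply: (@continuousD _ _ _ (cst x) id w); [exact: cst_continuous|exact: cvg_id]. Qed.

Fact ball_connected (x : 'rV[R]_n) (e : R) : connected (ball x e).
Proof.
have [e0|e0] := leP e 0.
  rewrite (_ : ball x e = set0); first exact: connected0.
  rewrite -subset0 => y; rewrite -ball_normE /ball_/= => /lt_le_trans/(_ e0).
  by rewrite ltNge normr_ge0.
pose seg (y : 'rV[R]_n) := (fun t : R => x + t *: (y - x)) @` `[0, 1].
rewrite (_ : ball x e = \bigcup_(y in ball x e) seg y).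
  apply: bigcup_connected.
    exists x => y _; exists 0; last by rewrite scale0r addr0.
    by rewrite /= in_itv /= lexx ler01.
  move=> y _; apply: connected_continuous_connected; first exact: segment_connected.
  apply: continuous_subspaceT => t; apply: cvgD; first exact: cvg_cst.
  by apply: cvgZr_tmp; exact: cvg_id.
apply/seteqP; split=> [y xy|_ [y xy [t /= + <-]]].
  exists y => //; exists 1; last by rewrite scale1r addrC subrK.
  by rewrite /= in_itv /= lexx ler01.
rewrite in_itv /= => /andP[t0 t1]; move: xy; rewrite -ball_normE /ball_/=.
rewrite opprD addNKr normrN normrZ ger0_norm// distrC; apply: le_lt_trans.
by rewrite ler_piMl.
Qed.

Fact shift_dom_open : open shift_dom.
Proof.
have So : open [set w | U (u + w)].
  apply: (@open_comp _ _ (fun w => u + w)); last exact: plot_open pU.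
  by move=> w _; exact: shift_continuous.
rewrite openE => w Sw.
have /nbhs_ballP[e /= e0 eS] : nbhs w [set w | U (u + w)].
  by apply: open_nbhs_nbhs; split=> //; exact: shift_dom_sub.
apply/nbhs_ballP; exists e => // z wz.
apply: (connected_component_trans Sw).
apply: (connected_component_max (B := ball w e)) => //; first exact: ballxx.
exact: ball_connected.
Qed.

Fact shift_smooth (V : set 'rV[R]_n) : smooth_on V (fun w => u + w).
Proof.
move=> [|k] /=; first by move=> w _; exact: shift_continuous.
have sdiff w : is_diff w (fun w : 'rV[R]_n => u + w) idfun.
  have H : is_diff w (cst u + id : 'rV[R]_n -> 'rV[R]_n) (0 + id).
    exact: is_diffD.
  by apply: is_diff_eq H _; rewrite add0r.
split=> [w _|v]; first by have := sdiff w => ?; exact: ex_diff.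
rewrite (_ : (fun w => _) = cst v); first exact: Ck_cst.
by apply/funext => w; rewrite (@diff_val _ _ _ _ _ _ _ (sdiff w)).
Qed.

Fact shift_plot : plot D shift_dom shift_map.
Proof.
apply: (plot_comp (f := fun w => u + w) pU shift_dom_open).
  exact: shift_smooth.
exact: shift_dom_sub.
Qed.

Fact shift_map0 : shift_map 0 = p u.
Proof. by rewrite /shift_map addr0. Qed.

Definition shift_pplot : pplot (p u) :=
  PPlot shift_plot shift_dom_connected shift_dom0 shift_map0.

End Shift.

(* [TU] is [U * R^n]. *)
Definition Tplot n (U : set 'rV[R]_n) (p : 'rV[R]_n -> X) (pU : plot D U p)
    (uv : {u | U u} * 'rV[R]_n) : tbundle :=
  existT _ (p (sval uv.1)) (@tvec _ (shift_pplot pU (svalP uv.1)) uv.2).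

Definition TU_diff n (U : set 'rV[R]_n) : diffeology R ({u | U u} * 'rV[R]_n) :=
  prod_diff (sub_diff (std 'rV[R]_n) U) (std 'rV[R]_n).

Definition hector_diff : diffeology R tbundle :=
  inter_diff [set E | forall n (U : set 'rV[R]_n) p (pU : plot D U p),
    smooth (TU_diff U) E (Tplot pU)].

Definition tfiber_product : set (tbundle * tbundle) :=
  [set ab | tproj ab.1 = tproj ab.2].

Definition tadd (ab : {ab | tfiber_product ab}) : tbundle :=
  let: exist (a, b) e := ab in
  existT _ (tproj a) (projT2 a + eq_rect_r tspace (projT2 b) e).

Definition tscale (ar : tbundle * R) : tbundle :=
  existT _ (tproj ar.1) (ar.2 *: projT2 ar.1).

Definition diffeological_vector_space_over (E : diffeology R tbundle) : Prop :=
  [/\ smooth E D tproj,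
      smooth (sub_diff (prod_diff E E) tfiber_product) E tadd &
      smooth (prod_diff E (std R)) E tscale].

Definition dvs_diff : diffeology R tbundle :=
  inter_diff [set E | finer hector_diff E /\ diffeological_vector_space_over E].

Lemma hector_Tplot n (U : set 'rV[R]_n) p (pU : plot D U p) :
  smooth (TU_diff U) hector_diff (Tplot pU).
Proof. by move=> m V f Vf; split=> [|E]; [exact: plot_open Vf|exact]. Qed.

Lemma hector_pull_tproj : finer hector_diff (pull_diff D tproj).
Proof.
move=> n U p [Uo]; apply=> m V q qV k W f [/= f1 f2].
have [Wo sf] := f1; apply: (plot_comp (f := sval \o (fst \o f)) qV) => //.
by move=> w _ /=; exact: svalP.
Qed.

Lemma hector_dvs : finer hector_diff dvs_diff.
Proof. by move=> n U p Hp; split=> [|E [HE _]]; [exact: plot_open Hp|exact: HE]. Qed.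

Lemma dvs_over : diffeological_vector_space_over dvs_diff.
Proof.
split=> [n U p [Uo H]|n U p [H1 H2]|n U p [[Uo H] Sp]].
- suff : plot (pull_diff D tproj) U p by [].
  apply: H; split; first exact: hector_pull_tproj.
  split=> // m V q; last by case.
  move=> [/= qa _]; apply: plot_ext qa => v _ /=.
  by case: (q v) => -[a b] e.
- split=> [|E [HE EE]]; first exact: plot_open H1.
  by have [_ + _] := EE; apply; split; [apply: H1.2|apply: H2.2].
- split=> // E [HE EE].
  by have [_ _] := EE; apply; split=> //; exact: H.
Qed.

End Tangent.

Arguments pp_dom {R X D x} p _.
Arguments pp_map {R X D x} p _.
Arguments gm_map {R X D x p q} g _.

(* Main.v *)
Require Import Defs.
From HB Require Import structures.
From mathcomp Require Import all_boot all_order all_algebra.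
From mathcomp Require Import all_classical all_reals all_analysis.
Import Order.TTheory GRing.Theory Num.Theory.
Import numFieldNormedType.Exports.
Set Implicit Arguments.
Unset Strict Implicit.
Unset Printing Implicit Defensive.

Local Open Scope classical_set_scope.
Local Open Scope ring_scope.

(** Hector's diffeology is contained in the diffeology of [T^dvs] for every
    diffeological space, so the point is that on a homogeneous space [X] it is
    already a diffeological vector space over [X].

    The main obstacle is the addition: two plots [w |-> Tp (f w)] and
    [w |-> Tq (g w)] of [TX] with the same projection come from unrelated plots
    [p : U -> X] and [q : V -> X], and their sum has to be of the form
    [Tr (h w)] for one plot [r].  If [X = G/H], lift [p] near a point
    to a plot [P] of [G] and put [tau u u' x = P(u) P(u')^-1 x].  This moves
    [p u'] to [p u], is the identity for [u = u'], and is smooth in all its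
    arguments; such a family is a [plot_transport], and
    [homogeneous_transportable] provides it.  Now let

      [r (u, v, u') = tau u u' (q v)].

    At a point [(u, v, u)] with [p u = q v], moving only the first variable
    recovers [p], since [tau (u + w) u (q v) = tau (u + w) u (p u) = p (u + w)],
    and moving only the second recovers [q].  As [T_x X] is a colimit, both
    inclusions of variables are germs along which tangent vectors are
    identified, and therefore

      [Tp (u, a) + Tq (v, b) = Tr ((u, v, u), (a, b, 0))],

    which is [Tplot_sum].  The right-hand side depends smoothly on [u, v, a, b],
    so the sum of two plots of the form [Tp \o f] is again of this form.

    The same identity shows that every element of [TX] is represented by a single
    vector at a single plot ([transportable_Tplot_value]).  Hence constant
    functions are of the form [Tp \o f] as well, Hector's plots are exactly the
    functions locally of this form, and the scalar multiplication is smooth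
    because [s Tp (u, a) = Tp (u, s a)]. *)

(** * Smooth maps between coordinate spaces *)

Section SmoothMaps.
Context {R : realType}.

Lemma linear_rV_continuous n (W : normedModType R)
  (L : {linear 'rV[R]_n -> W}) : continuous L.
Proof.
pose coordZ (i : 'I_n) (w : 'rV[R]_n) : W := w 0 i *: L (delta_mx 0 i).
suff cS : Ck 0 setT (\sum_(i < n) coordZ i).
  move=> w; rewrite (_ : (L : _ -> _) = \sum_(i < n) coordZ i); first exact: cS.
  by apply/funext => y; rewrite fct_sumE linear_row.
apply: Ck_sum => [|i]; first exact: openT.
apply: (Ck_scale (r := fun w : 'rV[R]_n => w 0 i)); first exact: openT.
- by move=> w _; exact: coord_continuous.
- exact: Ck_cst.
Qed.

Lemma smooth_on_linear m n (V : normedModType R) (U : set V)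
    (L : {linear 'rV[R]_m -> 'rV[R]_n}) (f : V -> 'rV[R]_m) :
  open U -> smooth_on U f -> smooth_on U (L \o f).
Proof.
by move=> Uo sf k; apply: Ck_lincomp => //; exact: linear_rV_continuous.
Qed.

Lemma smooth_onW (V W : normedModType R) (U U' : set V) (f : V -> W) :
  U' `<=` U -> smooth_on U f -> smooth_on U' f.
Proof. by move=> U'U sf k; exact: CkW (sf k). Qed.

Lemma smooth_on_preimage_open (V W : normedModType R) (U : set V) (A : set W)
  (f : V -> W) : open U -> open A -> smooth_on U f -> open (U `&` f @^-1` A).
Proof.
move=> Uo Ao sf; rewrite openE => x [Ux Afx].
apply: filterI; first exact: open_nbhs_nbhs.
by apply: (sf 0%N x Ux); exact: open_nbhs_nbhs.
Qed.

(** The inclusions of the two factors of [R^m x R^n]; as linear maps they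
    represent the germs that compare [p] and [q] with [r]. *)
Section RowBlocks.
Context {m n : nat}.

Definition row_inl (a : 'rV[R]_m) : 'rV[R]_(m + n) := row_mx a 0.
Definition row_inr (b : 'rV[R]_n) : 'rV[R]_(m + n) := row_mx 0 b.

Fact row_inl_is_linear : linear row_inl.
Proof. by move=> c a b; rewrite /row_inl scale_row_mx add_row_mx scaler0 addr0. Qed.
Fact row_inr_is_linear : linear row_inr.
Proof. by move=> c a b; rewrite /row_inr scale_row_mx add_row_mx scaler0 addr0. Qed.
HB.instance Definition _ := GRing.isLinear.Build _ _ _ _ _ row_inl_is_linear.
HB.instance Definition _ := GRing.isLinear.Build _ _ _ _ _ row_inr_is_linear.

Lemma row_mx_inlr a b : row_mx a b = row_inl a + row_inr b.
Proof. by rewrite /row_inl /row_inr add_row_mx addr0 add0r. Qed.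

Lemma smooth_on_row_mx (V : normedModType R) (U : set V)
    (f : V -> 'rV[R]_m) (g : V -> 'rV[R]_n) :
  open U -> smooth_on U f -> smooth_on U g ->
  smooth_on U (fun x => row_mx (f x) (g x)).
Proof.
move=> Uo sf sg k.
rewrite (_ : (fun x => _) = (row_inl \o f) + (row_inr \o g)); last first.
  by apply/funext => x; rewrite row_mx_inlr.
by apply: Ck_add => //; exact: smooth_on_linear.
Qed.

End RowBlocks.

(** The sheaf condition, with a neighbourhood chosen for each point. *)
Lemma plot_local_at (X : Type) (D : diffeology R X) n (U : set 'rV[R]_n) p :
  (forall u, U u -> exists W : set 'rV[R]_n, [/\ W u, W `<=` U & plot D W p]) ->
  plot D U p.
Proof.
move=> H; pose C := [set W : set 'rV[R]_n | W `<=` U /\ plot D W p].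
suff -> : U = \bigcup_(W in C) W by apply: plot_local => W [].
apply/seteqP; split=> [u /H[W [Wu WU pW]]|u [W [WU _] Wu]]; last exact: WU.
by exists W.
Qed.

End SmoothMaps.

(** * Moving points along a plot *)

Section Transport.
Context {R : realType} {X : Type} (D : diffeology R X).

(** [tau u v] is to be thought of as a symmetry of [X] moving [p v] to [p u] and
    depending smoothly on [u] and [v] in [W].  Its smoothness as a map from
    [W x W x X] is expressed by its effect on plots, so that no diffeology on
    [W x W x X] has to be handled. *)
Definition plot_transport n (p : 'rV[R]_n -> X) (W : set 'rV[R]_n)
    (tau : 'rV[R]_n -> 'rV[R]_n -> X -> X) : Prop :=
  [/\ forall u v, W u -> W v -> tau u v (p v) = p u,
      forall u x, tau u u x = x &
      forall k (O : set 'rV[R]_k) a b q,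
        smooth_on O a -> smooth_on O b -> (forall z, O z -> W (a z)) ->
        (forall z, O z -> W (b z)) -> plot D O q ->
        plot D O (fun z => tau (a z) (b z) (q z))].

Definition transportable : Prop :=
  forall n (U : set 'rV[R]_n) p, plot D U p -> forall u, U u ->
  exists W tau, [/\ open W, W u & plot_transport p W tau].

End Transport.

(** * Homogeneous spaces *)

Section CosetAction.
Context {G : groupType} (H : {pred G}).

(** The action of [G] on [G/H] by left translation, computed on a chosen
    representative; [coset_act_proj] shows that the choice is immaterial. *)
Definition coset_act (g : G) (C : coset_space H) : coset_space H :=
  coset_proj H (g * projT1 (cid (coset_proj_surj C)))%g.

Lemma coset_setM (g h : G) :
  coset_set H (g * h)%g = [set (g * k)%g | k in coset_set H h].
Proof.
apply/seteqP; split=> [_ [h' Hh' <-]|_ [_ [h' Hh' <-] <-]].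
  by exists (h * h')%g; [exists h'|rewrite mulgA].
by exists h' => //; rewrite mulgA.
Qed.

Lemma coset_act_proj g h :
  coset_act g (coset_proj H h) = coset_proj H (g * h)%g.
Proof.
rewrite /coset_act; case: cid => h' /= /(congr1 sval)/= hh'.
by apply: eq_exist; rewrite /= !coset_setM hh'.
Qed.

End CosetAction.

(** With [P] a local lift of [p] to [G], the element [P(u) P(v)^-1] moves the coset
    of [P(v)] to that of [P(u)] and is the identity for [u = v].  Its action on a
    plot [q] of [X] is smooth because [q] lifts locally to a plot [Q] of [G], and
    [P(u) P(v)^-1 Q] is a plot of [G]. *)
Lemma homogeneous_transportable (R : realType) (X : Type) (D : diffeology R X) :
  homogeneous D -> transportable D.
Proof.
move=> [G [DG [H [[mul_sm inv_sm] _ [f [f_sm [finv [finv_sm fK finvK]]]]]]]].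
move=> n U p pU u Uu.
have [_ /(_ u Uu)[W [P [Wu _ PW fpE]]]] := f_sm _ _ _ pU.
exists W, (fun v w x => finv (coset_act (P v * (P w)^-1)%g (f x))).
split=> //; first exact: plot_open PW.
split=> [v w Wv Ww|v x|k O a b q sa sb aW bW qO].
- by rewrite -[f (p w)]/((f \o p) w) fpE// coset_act_proj mulgVK -fpE//= fK.
- have [g gE] := coset_proj_surj (f x).
  by rewrite -gE coset_act_proj mulgV mul1g gE fK.
- have Oo := plot_open qO.
  apply: (finv_sm _ O (fun z => coset_act (P (a z) * (P (b z))^-1)%g (f (q z)))).
  have [_ fqO] := f_sm _ _ _ qO; split=> // z Oz.
  have [N [Q [Nz NO QN fqE]]] := fqO z Oz.
  have No := plot_open QN.
  exists N, (fun z => (P (a z) * (P (b z))^-1 * Q z)%g); split=> //; last first.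
    by move=> w Nw; rewrite -[f (q w)]/((f \o q) w) fqE// coset_act_proj.
  have Pa : plot DG N (P \o a).
    by apply: (plot_comp PW) => // [|w /NO/aW//]; exact: smooth_onW sa.
  have Pb : plot DG N (P \o b).
    by apply: (plot_comp PW) => // [|w /NO/bW//]; exact: smooth_onW sb.
  apply: (mul_sm _ _ (fun z => (P (a z) * (P (b z))^-1, Q z))%g); split=> //.
  apply: (mul_sm _ _ (fun z => (P (a z), (P (b z))^-1))%g); split=> //.
  exact: inv_sm Pb.
Qed.

(** * Sums of tangent vectors at different plots *)

Section TangentSum.
Context {R : realType} {X : Type} (D : diffeology R X).

(** A linear map that commutes with two pointed plots defines a germ between
    them, and it is its own derivative. *)
Lemma tvec_linear x (P S : pplot D x)
    (L : {linear 'rV[R]_(pp_dim P) -> 'rV[R]_(pp_dim S)}) v :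
  (forall w, pp_dom P w -> pp_dom S (L w) -> pp_map P w = pp_map S (L w)) ->
  tvec (p := S) (L v) = tvec v.
Proof.
move=> PS; pose O := pp_dom P `&` L @^-1` pp_dom S.
have cL := @linear_rV_continuous _ _ _ L.
have Oo : open O.
  apply: openI; first exact: plot_open (pp_plot P).
  by apply: open_comp => [w _|]; [exact: cL|exact: plot_open (pp_plot S)].
have O0 : O 0 by split; [exact: pp_dom0|rewrite /= linear0; exact: pp_dom0].
have Ls : smooth_on O L by move=> k; exact: Ck_lin.
have LO w : O w -> pp_dom S (L w) by case.
have Lc w : O w -> pp_map P w = pp_map S (L w) by case; exact: PS.
pose g : germ P S := Germ Oo O0 (@subIsetl _ _ _) Ls LO (linear0 L) Lc.
rewrite -[RHS](colim_in_map (G := tangent_functor D x) g) /=.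
by rewrite (diff_lin (0 : 'rV[R]_(pp_dim P)) cL).
Qed.

Lemma tadd_existT x (s t : tspace D x) e :
  tadd (exist _ (existT _ x s, existT _ x t) e) =
  existT (tspace D) x (s + t) :> tbundle D.
Proof. by rewrite /tadd /= (_ : e = erefl)//; exact: Prop_irrelevance. Qed.

(** The vectors may be based at different points [x], [y], [z] of [X] which are
    only provably equal: this is how the addition on [TX] meets them, its two
    arguments being values of [Tp] and [Tq]. *)
Lemma tadd_tvec x y z (P : pplot D x) (Q : pplot D y) (S : pplot D z)
    (L : {linear 'rV[R]_(pp_dim P) -> 'rV[R]_(pp_dim S)})
    (M : {linear 'rV[R]_(pp_dim Q) -> 'rV[R]_(pp_dim S)}) a b e :
  x = z ->
  (forall w, pp_dom P w -> pp_dom S (L w) -> pp_map P w = pp_map S (L w)) ->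
  (forall w, pp_dom Q w -> pp_dom S (M w) -> pp_map Q w = pp_map S (M w)) ->
  tadd (exist _ (existT _ x (tvec (p := P) a), existT _ y (tvec (p := Q) b)) e) =
  existT _ z (tvec (p := S) (L a + M b)).
Proof.
move=> xz PS QS; have xy : x = y := e; subst y z.
rewrite tadd_existT -(tvec_linear _ PS) -(tvec_linear _ QS).
by congr existT; rewrite -linearD.
Qed.

Lemma existT_tvec_linear x z (P : pplot D x) (S : pplot D z)
    (L : {linear 'rV[R]_(pp_dim P) -> 'rV[R]_(pp_dim S)}) v :
  x = z ->
  (forall w, pp_dom P w -> pp_dom S (L w) -> pp_map P w = pp_map S (L w)) ->
  existT _ z (tvec (p := S) (L v)) = existT _ x (tvec (p := P) v) :> tbundle D.
Proof. by move=> xz PS; subst z; rewrite tvec_linear. Qed.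

Lemma TplotE n (U : set 'rV[R]_n) p (pU : plot D U p) u (Uu : U u) a :
  Tplot pU (exist _ u Uu, a) = existT _ (p u) (tvec (p := shift_pplot pU Uu) a).
Proof.
by rewrite /Tplot; set Uu' := svalP _; rewrite (Prop_irrelevance Uu' Uu).
Qed.

(** Every vector at a pointed plot [P] is a value of [TP]: the translate of [P] by
    [0] is the restriction of [P] to a smaller domain. *)
Lemma Tplot_pplot x (P : pplot D x) v :
  Tplot (pp_plot P) (exist _ 0 (pp_dom0 P), v) = existT _ x (tvec (p := P) v).
Proof.
have P0 := pp_map0 P.
pose S := shift_pplot (pp_plot P) (pp_dom0 P).
have SP w : pp_dom S w -> pp_dom P w -> pp_map S w = pp_map P w.
  by rewrite /= /shift_map add0r.
by rewrite TplotE; exact: (esym (@existT_tvec_linear _ _ S P idfun v P0 SP)).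
Qed.

(** The plot [r (u, v, u') = tau u u' (q v)]. *)
Section SumPlot.
Context {m n : nat} {U : set 'rV[R]_m} {V : set 'rV[R]_n}.
Context {p : 'rV[R]_m -> X} {q : 'rV[R]_n -> X} (pU : plot D U p) (qV : plot D V q).
Context {W : set 'rV[R]_m} {tau : 'rV[R]_m -> 'rV[R]_m -> X -> X}.
Context (Wo : open W) (ptau : plot_transport D p W tau).

Definition sum_dom : set 'rV[R]_(m + n + m) :=
  [set z | [/\ W (lsubmx (lsubmx z)), V (rsubmx (lsubmx z)) & W (rsubmx z)]].

Definition sum_map (z : 'rV[R]_(m + n + m)) : X :=
  tau (lsubmx (lsubmx z)) (rsubmx z) (q (rsubmx (lsubmx z))).

Definition sum_point (u : 'rV[R]_m) (v : 'rV[R]_n) : 'rV[R]_(m + n + m) :=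
  row_mx (row_mx u v) u.

Lemma sum_dom_point u v : W u -> V v -> sum_dom (sum_point u v).
Proof. by move=> Wu Vv; split; rewrite ?row_mxKl ?row_mxKr. Qed.

Lemma sum_map_row u v u' : sum_map (row_mx (row_mx u v) u') = tau u u' (q v).
Proof. by rewrite /sum_map !(row_mxKl, row_mxKr). Qed.

Lemma sum_plot : plot D sum_dom sum_map.
Proof.
have [_ _ tau_plot] := ptau.
have So : open sum_dom.
  have Vo := plot_open qV.
  rewrite (_ : sum_dom = (lsubmx \o lsubmx) @^-1` W `&`
    ((rsubmx \o lsubmx) @^-1` V `&` rsubmx @^-1` W)).
    by apply: openI; [|apply: openI]; apply: open_comp => // z _;
      exact: linear_rV_continuous.
  by apply/seteqP; split=> [z []//|z [? []]].
have sub_smooth l (L : {linear 'rV[R]_(m + n + m) -> 'rV[R]_l}) :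
  smooth_on sum_dom L.
  by move=> k; apply: Ck_lin; exact: linear_rV_continuous.
apply: tau_plot => [||z []|z []|] //.
- exact: (sub_smooth _ (lsubmx \o lsubmx)).
- apply: (plot_comp qV) => // [|z []//].
  exact: (sub_smooth _ (rsubmx \o lsubmx)).
Qed.

(** At [(u, v, u)], the plot [r] restricts to [p] along the first variable and to
    [q] along the second. *)
Lemma Tplot_sum u v (Uu : U u) (Vv : V v) (Suv : sum_dom (sum_point u v))
    (a : 'rV[R]_m) (b : 'rV[R]_n) e :
  tadd (exist _ (Tplot pU (exist _ u Uu, a), Tplot qV (exist _ v Vv, b)) e) =
  Tplot sum_plot (exist _ (sum_point u v) Suv, row_mx (row_mx a b) 0).
Proof.
have [tau_p tau_id _] := ptau.
have [Wu _ _] := Suv; rewrite /sum_point !row_mxKl in Wu.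
have pq : p u = q v := e.
have {1}-> : row_mx (row_mx a b) 0 =
    (row_inl \o row_inl) a + (row_inl \o row_inr) b :> 'rV[R]_(m + n + m).
  by rewrite /= /row_inl /row_inr !add_row_mx !(addr0, add0r).
move: e; rewrite !TplotE => e.
pose l1 : {linear 'rV[R]_m -> 'rV[R]_(m + n + m)} := row_inl \o row_inl.
pose l2 : {linear 'rV[R]_n -> 'rV[R]_(m + n + m)} := row_inl \o row_inr.
apply: (@tadd_tvec _ _ _ (shift_pplot pU Uu) (shift_pplot qV Vv)
  (shift_pplot sum_plot Suv) l1 l2).
- by rewrite sum_map_row tau_id.
- move=> w _ /shift_dom_sub; rewrite /= /shift_map.
  rewrite (_ : sum_point u v + l1 w = row_mx (row_mx (u + w) v) u); last first.
    by rewrite /sum_point /l1 /= /row_inl !add_row_mx !addr0.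
  by case; rewrite !(row_mxKl, row_mxKr) sum_map_row -pq => ? _ _; rewrite tau_p.
- move=> w _ _; rewrite /= /shift_map.
  rewrite (_ : sum_point u v + l2 w = row_mx (row_mx u (v + w)) u); last first.
    by rewrite /sum_point /l2 /= /row_inl /row_inr !add_row_mx !addr0.
  by rewrite sum_map_row tau_id.
Qed.

End SumPlot.
End TangentSum.

(** * Hector's plots in the presence of transports *)

Section HectorPlots.
Context {R : realType} {X : Type} (D : diffeology R X).

Definition Tplot_value (t : tbundle D) : Prop :=
  exists n (U : set 'rV[R]_n) p (pU : plot D U p) uv, t = Tplot pU uv.

(** An element of the colimit is a finite formal sum of vectors at pointed plots;
    [Tplot_sum] merges its terms one by one. *)
Lemma transportable_Tplot_value : transportable D -> forall t, Tplot_value t.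
Proof.
move=> trD [x t]; rewrite -(crepK t); elim: (crep t) => [|[P v] s IH].
  have O : plot D setT (cst x : 'rV[R]_0 -> X) by apply: plot_cst; exact: openT.
  have cT : connected [set: 'rV[R]_0].
    rewrite (_ : setT = [set 0]); first exact: connected1.
    by apply/seteqP; split=> // z _ /=; rewrite thinmx0.
  pose P : pplot D x := PPlot O cT I erefl.
  exists 0%N, setT, (cst x), O, (exist _ 0 I, 0).
  rewrite (@Tplot_pplot _ _ _ _ P 0); congr existT; apply/cpiP.
  exact/fsum_sym/(@fsum_zero _ (tangent_functor D x) P).
have [n [V [q [qV [[[v0 Vv0] b] sE]]]]] := IH.
have [W [tau [Wo W0 tr]]] := trD _ _ _ (pp_plot P) _ (pp_dom0 P).
have S0 := sum_dom_point (V := V) W0 Vv0.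
exists _, _, _, (sum_plot qV Wo tr), (exist _ _ S0, row_mx (row_mx v b) 0).
have e : tfiber_product (Tplot (pp_plot P) (exist _ 0 (pp_dom0 P), v),
    Tplot qV (exist _ v0 Vv0, b)).
  by rewrite -sE /tfiber_product /=; exact: pp_map0.
rewrite -(Tplot_sum Wo tr S0 e).
move: e; rewrite -sE Tplot_pplot => e; rewrite tadd_existT; congr existT.
exact/esym/(cpiD (single v) s).
Qed.

(** [c = Tp \o (g, h)] on [O].  The two components of a map into [TU] are kept
    apart, as total functions, so that their smoothness can be stated for maps
    between coordinate spaces. *)
Definition Tplot_lift k (O : set 'rV[R]_k) (c : 'rV[R]_k -> tbundle D) : Prop :=
  exists n (U : set 'rV[R]_n) p (pU : plot D U p) g h,
  [/\ smooth_on O g, smooth_on O h &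
      forall w, O w -> exists Uw : U (g w), c w = Tplot pU (exist _ (g w) Uw, h w)].

(** Constant functions are of this form as soon as every tangent vector is a
    value of some [Tp]; see [locally_Tplot_cst]. *)
Definition locally_Tplot k (O : set 'rV[R]_k) (c : 'rV[R]_k -> tbundle D) : Prop :=
  open O /\ forall w, O w ->
    exists N : set 'rV[R]_k, [/\ open N, N w, N `<=` O & Tplot_lift N c].

Fact locally_Tplot_open k (O : set 'rV[R]_k) c : locally_Tplot O c -> open O.
Proof. by case. Qed.
Fact locally_Tplot_ext k (O : set 'rV[R]_k) c d :
  (forall u, O u -> c u = d u) -> locally_Tplot O c -> locally_Tplot O d.
Proof.
move=> cd [Oo H]; split=> // w /H[N [No Nw NO]].
move=> [n [U [p [pU [g [h [sg sh cE]]]]]]].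
exists N; split=> //; exists n, U, p, pU, g, h; split=> // z Nz.
by rewrite -cd; [exact: cE|exact: NO].
Qed.
Fact locally_Tplot_comp m n (O : set 'rV[R]_n) (V : set 'rV[R]_m) c f :
  locally_Tplot O c -> open V -> smooth_on V f -> (forall v, V v -> O (f v)) ->
  locally_Tplot V (c \o f).
Proof.
move=> [Oo H] Vo sf fVO; split=> // v Vv.
have [N [No Nv NO [l [U [p [pU [g [h [sg sh cE]]]]]]]]] := H _ (fVO _ Vv).
have V'o := smooth_on_preimage_open Vo No sf.
have sf' : smooth_on (V `&` f @^-1` N) f by apply: smooth_onW sf => z [].
exists (V `&` f @^-1` N); split=> //.
exists l, U, p, pU, (g \o f), (h \o f); split=> [k|k|z [_ Nz]]; last exact: cE.
  by apply: (Ck_comp V'o _ (sf' k) (sg k)) => z [].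
by apply: (Ck_comp V'o _ (sf' k) (sh k)) => z [].
Qed.
Fact locally_Tplot_local n (C : set (set 'rV[R]_n)) c :
  (forall O, C O -> locally_Tplot O c) -> locally_Tplot (\bigcup_(O in C) O) c.
Proof.
move=> H; split=> [|u [A CA Au]]; first by apply: bigcup_open => A /H[].
have [_ /(_ u Au)[N [No Nu NA Nc]]] := H _ CA.
by exists N; split=> // z Nz; exists A => //; exact: NA.
Qed.

Section WithTransport.
Context (trD : transportable D).

Fact locally_Tplot_cst n (O : set 'rV[R]_n) t : open O -> locally_Tplot O (cst t).
Proof.
move=> Oo; split=> // w Ow; exists O; split=> //.
have [l [U [p [pU [[[u Uu] a] tE]]]]] := transportable_Tplot_value trD t.
exists l, U, p, pU, (cst u), (cst a).
by split=> [k|k|z _]; [exact: Ck_cst|exact: Ck_cst|exists Uu; exact: tE].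
Qed.

Definition locally_Tplot_diff : diffeology R (tbundle D) :=
  Diffeology locally_Tplot_open locally_Tplot_ext locally_Tplot_cst
    locally_Tplot_comp locally_Tplot_local.

(** Hector's diffeology is the smallest one containing all [Tp], and the functions
    that are locally of the form [Tp \o f] form a diffeology. *)
Lemma hector_locally_Tplot k (O : set 'rV[R]_k) c :
  plot (hector_diff D) O c -> locally_Tplot O c.
Proof.
move=> [_ /(_ locally_Tplot_diff)]; apply.
move=> n U p pU m V f [/= [Vo sf] [_ sh]]; split=> // w Vw; exists V; split=> //.
exists n, U, p, pU, (sval \o (fst \o f)), (snd \o f); split=> // z _.
by rewrite /=; case: (f z) => -[u Uu] a; exists Uu.
Qed.

Lemma Tplot_lift_hector k (O : set 'rV[R]_k) c :
  open O -> Tplot_lift O c -> plot (hector_diff D) O c.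
Proof.
move=> Oo [n [U [p [pU [g [h [sg sh cE]]]]]]].
apply: plot_local_at => u0 Ou0; exists O; split=> //.
have [Uu0 _] := cE _ Ou0.
(* [g] may leave [U] outside [O]; its value at [u0] serves as a default there. *)
pose lift w := if pselect (U (g w)) is left Uw then exist U (g w) Uw
  else exist U (g u0) Uu0.
have liftE w (Uw : U (g w)) : lift w = exist U (g w) Uw.
  rewrite /lift; case: pselect => // Uw'.
  by congr exist; exact: Prop_irrelevance.
apply: (@plot_ext _ _ _ _ _ (Tplot pU \o (fun w => (lift w, h w)))).
  by move=> w /cE[Uw ->] /=; rewrite liftE.
apply: hector_Tplot; split; split=> //.
move=> l; apply: (Ck_ext Oo _ (sg l)) => w /cE[Uw _] /=.
by rewrite liftE.
Qed.

(** Both summands are locally of the form [Tp \o (g, h)] and [Tq \o (g', h')], and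
    [Tplot_sum] exhibits their sum as [Tr \o ((g, g', g), (h, h', 0))]. *)
Lemma tadd_hector :
  smooth (sub_diff (prod_diff (hector_diff D) (hector_diff D)) (@tfiber_product R X D))
    (hector_diff D) (@tadd R X D).
Proof.
move=> k O c [c1 c2].
have [Oo H1] := hector_locally_Tplot c1; have [_ H2] := hector_locally_Tplot c2.
apply: plot_local_at => w0 Ow0.
have [N1 [N1o N1w N1O [n [U [p [pU [g [h [sg sh cE1]]]]]]]]] := H1 _ Ow0.
have [N2 [N2o N2w N2O [m [V [q [qV [g' [h' [sg' sh' cE2]]]]]]]]] := H2 _ Ow0.
have [Uw0 _] := cE1 _ N1w.
have [W [tau [Wo Ww tr]]] := trD pU Uw0.
pose N := (N1 `&` g @^-1` W) `&` N2.
have No : open N by apply: openI => //; exact: smooth_on_preimage_open.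
have NN1 : N `<=` N1 by move=> z [[]].
have NN2 : N `<=` N2 by move=> z [].
have NO : N `<=` O by move=> z /NN1/N1O.
exists N; split=> //; apply: Tplot_lift_hector => //.
exists _, _, _, (sum_plot qV Wo tr),
  (fun z => row_mx (row_mx (g z) (g' z)) (g z)),
  (fun z => row_mx (row_mx (h z) (h' z)) 0).
have sub1 := @smooth_onW _ _ _ _ _ _ NN1; have sub2 := @smooth_onW _ _ _ _ _ _ NN2.
split.
- by do ?apply: smooth_on_row_mx => //; [exact: sub1|exact: sub2|exact: sub1].
- apply: smooth_on_row_mx => //; last by move=> l; exact: Ck_cst.
  by apply: smooth_on_row_mx => //; [exact: sub1|exact: sub2].
move=> z Nz; have [[N1z Wz] N2z] := Nz.
have [Uz /= E1] := cE1 _ N1z; have [Vz /= E2] := cE2 _ N2z.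
exists (sum_dom_point (Wz : W (g z)) Vz).
move: E1 E2; case: (c z) => -[a b] e /= E1 E2; subst a b.
exact: Tplot_sum.
Qed.

Lemma tscale_hector :
  smooth (prod_diff (hector_diff D) (std R)) (hector_diff D) (@tscale R X D).
Proof.
move=> k O c [c1 [Oo sr]].
have [_ H] := hector_locally_Tplot c1.
apply: plot_local_at => w Ow.
have [N [No Nw NO [n [U [p [pU [g [h [sg sh cE]]]]]]]]] := H _ Ow.
exists N; split=> //; apply: Tplot_lift_hector => //.
exists n, U, p, pU, g, (fun z => (c z).2 *: h z); split=> // [l|z Nz].
  by apply: Ck_scale => //; exact: CkW (sr l).
have [Uz /= E] := cE _ Nz; exists Uz; rewrite /tscale /= E !TplotE /=.
by congr existT; rewrite /tvec linearZ.
Qed.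

Lemma transportable_hector_dvs : diffeological_vector_space_over (hector_diff D).
Proof.
split; [exact: hector_pull_tproj|exact: tadd_hector|exact: tscale_hector].
Qed.

End WithTransport.
End HectorPlots.

(** * The two diffeologies agree *)

Theorem proposition4p13 (R : realType) (X : Type) (D : diffeology R X) :
  homogeneous D -> hector_diff D = dvs_diff D.
Proof.
move=> /homogeneous_transportable trD.
apply: diffeology_eq => n U c; split; first exact: hector_dvs.
move=> [_]; apply; split=> //; exact: transportable_hector_dvs.
Qed.
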